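(* A four-edge connected finite undirected simple graph $G=(V,E)$ contains a $\mathrm{PHC}_3$ if and only if $|V|$ is even or $G$ is non-bipartite.
   Context: A closed walk is a sequence $v_0e_1v_1\cdots e_\ell v_\ell$ with $e_i=\{v_{i-1},v_i\}\in E$ and $v_\ell=v_0$; vertices and edges may be repeated. The visit number of a vertex $v$ is the number of indices $i\in\{1,\dots,\ell\}$ with $v_i=v$. A parity Hamiltonian cycle (PHC) is a closed walk in which every vertex has odd visit number. A $\mathrm{PHC}_3$ is a PHC in which each edge occurs at most $3$ times. A graph is $k$-edge connected if it remains connected after removal of any $k-1$ edges. *)

(* Defs.v *)
From mathcomp Require Import all_boot.

Set Implicit Arguments.
Unset Strict Implicit.
Unset Printing Implicit Defensive.

Section Graphs.

Variable V : finType.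

(* A simple graph on V is given by its edge set, whose members are unordered
   pairs of distinct vertices. *)
Implicit Types (E F : {set {set V}}) (x y v : V) (p : seq V).

Definition simple_graph E : Prop := forall f : {set V}, f \in E -> #|f| = 2.

Definition adj E : rel V := fun x y => [set x; y] \in E.

(* The null graph is not regarded as connected. *)
Definition connected E : Prop :=
  0 < #|V| /\ forall x y, connect (adj E) x y.

(* Removal of at most k - 1 edges, so that graphs having fewer than k - 1 edges
   do not qualify vacuously. *)
Definition edge_connected (k : nat) E : Prop :=
  forall F, F \subset E -> #|F| < k -> connected (E :\: F).

Definition bipartite E : Prop :=
  exists A : {set V}, forall x y, adj E x y -> (x \in A) != (y \in A).

(* The closed walk v_0 e_1 v_1 ... e_l v_l is encoded by v_0 and the sequence
   p = [:: v_1; ...; v_l]; in a simple graph the e_i are determined by it. *)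
Definition closed_walk E (v0 : V) p : Prop := path (adj E) v0 p /\ last v0 p = v0.

Definition walk_edges (v0 : V) p : seq {set V} :=
  pairmap (fun x y => [set x; y]) v0 p.

(* The initial v_0 is not listed in p, so the start of the walk is counted once only,
   as v_l. *)
Definition visit_number p v : nat := count_mem v p.

Definition PHC E (v0 : V) p : Prop :=
  closed_walk E v0 p /\ forall v, odd (visit_number p v).

Definition PHC_le (k : nat) E (v0 : V) p : Prop :=
  PHC E v0 p /\ forall f, f \in E -> count_mem f (walk_edges v0 p) <= k.

End Graphs.

(* Main.v *)
(* Visits to the two sides of a bipartition alternate along a closed walk, so in a
   bipartite graph with a PHC both sides have the same parity.

   Conversely, choose a closed walk c using each edge at most once whose length has the
   parity of |V|: the empty walk, or an odd cycle.  By the Tutte-Nash-Williams theorem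
   there are disjoint connected spanning edge sets F1 and F2.  The set F2 contains a
   T-join J for every even T, so J can be chosen to make visits_c(v) + deg_{F1 u J}(v)
   odd for all v.  As F1 u J is connected, each of its edges {u, v} can be inserted into
   c as a detour u, v, u, which adds one visit to both ends; every edge is then used at
   most 1 + 2 times. *)
Require Import Defs.
From mathcomp Require Import all_boot.

Set Implicit Arguments.
Unset Strict Implicit.
Unset Printing Implicit Defensive.

(** * Components and forests *)

Section Connectivity.

Variable V : finType.
Implicit Types (A B E F : {set {set V}}) (e f U : {set V}) (x y z u v : V).

Lemma simple_edgeP E f : simple_graph E -> f \in E ->
  exists x y, x != y /\ f = [set x; y].
Proof.
move=> sE /sE/eqP/cards2P[x [y [nxy ->]]]; by exists x, y.
Qed.

Lemma simple_graphS E F : F \subset E -> simple_graph E -> simple_graph F.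
Proof. by move=> /subsetP sFE sE f /sFE/sE. Qed.

Lemma adj_neq E x y : simple_graph E -> adj E x y -> x != y.
Proof. by move=> sE /sE; rewrite cards2; case: eqP. Qed.

Lemma adj_sym E : symmetric (adj E).
Proof. by move=> x y; rewrite /adj setUC. Qed.

Lemma conn_sym E : connect_sym (adj E).
Proof. exact/sym_connect_sym/adj_sym. Qed.

Lemma connS A B x y : A \subset B ->
  connect (adj A) x y -> connect (adj B) x y.
Proof.
move=> /subsetP sAB; apply: connect_sub => u v uv.
exact/connect1/sAB.
Qed.

Lemma eq_set2 x y u v : [set x; y] = [set u; v] ->
  (x = u /\ y = v) \/ (x = v /\ y = u).
Proof.
move=> eqs; have ux : u \in [set x; y] by rewrite eqs set21.
have vx : v \in [set x; y] by rewrite eqs set22.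
have: x \in [set u; v] by rewrite -eqs set21.
have: y \in [set u; v] by rewrite -eqs set22.
move: ux vx; rewrite !inE.
by do 4!case/pred2P=> ?; subst; auto.
Qed.

(** Induction along the path keeps at most one crossing of the new edge: two crossings in opposite
    directions cancel, two in the same direction merge. *)
Lemma conn_add A u v x y : connect (adj ([set u; v] |: A)) x y ->
  [\/ connect (adj A) x y,
      connect (adj A) x u /\ connect (adj A) v y |
      connect (adj A) x v /\ connect (adj A) u y].
Proof.
case/connectP=> p; elim: p x => [|z p IHp] x /=; first by move=> _ ->; constructor 1.
case/andP=> xz /IHp{}IHp /IHp{IHp}; move: xz; rewrite /adj !inE.
case/orP=> [/eqP/eq_set2[] [-> ->]|xz].
- by case=> [?|[_ ?]|[_ ?]]; [constructor 2 | constructor 2 | constructor 1].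
- by case=> [?|[_ ?]|[_ ?]]; [constructor 3 | constructor 1 | constructor 3].
- by case=> [zy|[zy ?]|[zy ?]]; have := connect_trans (connect1 (xz : adj A x z)) zy;
    [constructor 1 | constructor 2 | constructor 3].
Qed.

(** Acyclicity in the form that every edge is a bridge. *)
Definition forest F : bool :=
  [forall x, forall y, ([set x; y] \in F) ==> ~~ connect (adj (F :\ [set x; y])) x y].

Lemma forestP F :
  reflect (forall x y, [set x; y] \in F -> ~~ connect (adj (F :\ [set x; y])) x y)
          (forest F).
Proof.
apply: (iffP forallP) => [h x y | h x]; first by move/forallP/(_ y)/implyP: (h x).
by apply/forallP=> y; apply/implyP/h.
Qed.

Lemma forestS A F : A \subset F -> forest F -> forest A.
Proof.
move=> sAF /forestP fF; apply/forestP=> x y xyA.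
apply: contra (fF x y (subsetP sAF _ xyA)); exact/connS/setSD.
Qed.

Lemma forest0 : forest set0.
Proof. by apply/forestP=> x y; rewrite inE. Qed.

Lemma forest_add F x y :
  forest F -> ~~ connect (adj F) x y -> forest ([set x; y] |: F).
Proof.
move=> /forestP fF nxy; apply/forestP=> u v uvF; apply/negP.
have [eq_uv|neq_uv] := eqVneq [set u; v] [set x; y].
  move=> uv; case/negP: nxy.
  have {}uv : connect (adj F) u v.
    by apply: connS uv; apply/subsetP=> f; rewrite eq_uv !inE; case: eqP.
  by case: (eq_set2 eq_uv) uv => [] [-> ->]; rewrite // conn_sym.
move: uvF; rewrite !inE (negPf neq_uv) /= => uvF.
have -> : ([set x; y] |: F) :\ [set u; v] = [set x; y] |: (F :\ [set u; v]).
  apply/setP=> f; rewrite !inE; case: (eqVneq f [set x; y]) => // ->.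
  by rewrite eq_sym neq_uv.
have wF a b : connect (adj (F :\ [set u; v])) a b -> connect (adj F) a b.
  exact/connS/subsetDl.
have Fuv : connect (adj F) u v by apply: connect1.
(* A connection that uses the new edge, closed up by the edge from [u] to [v], would join [x] to [y]
   inside [F]. *)
case/conn_add=> [|[/wF ux /wF yv]|[/wF uy /wF xv]]; first exact/negP/fF.
- case/negP: nxy; rewrite conn_sym in ux; rewrite conn_sym in yv.
  exact: connect_trans (connect_trans ux Fuv) yv.
- case/negP: nxy; rewrite conn_sym; rewrite conn_sym in uy; rewrite conn_sym in xv.
  exact: connect_trans (connect_trans uy Fuv) xv.
Qed.

(* The edges of a minimal subset of [F] joining [x] to [y] form the path from
   [x] to [y] in the forest [F], so each of them separates [x] from [y]. *)
Lemma forest_path F x y : simple_graph F -> forest F -> connect (adj F) x y ->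
  exists2 A : {set {set V}}, A \subset F &
    connect (adj A) x y /\ forall f, f \in A -> ~~ connect (adj (F :\ f)) x y.
Proof.
move=> sF /forestP fF Fxy.
have [A /minsetP[Axy minA] sAF] :=
  @minset_exists _ (fun A => connect (adj A) x y) F Fxy.
exists A => //; split=> // f fA; apply/negP=> Ffxy.
have [u [v [_ def_f]]] := simple_edgeP sF (subsetP sAF _ fA).
have nAf : ~~ connect (adj (A :\ f)) x y.
  apply/negP=> /minA/(_ (subsetDl _ _))/setP/(_ f).
  by rewrite fA !inE eqxx.
have wA a b : connect (adj (A :\ f)) a b -> connect (adj (F :\ f)) a b.
  exact/connS/setSD.
have := fF u v; rewrite -def_f (subsetP sAF) // => /(_ isT)/negP; apply.
(* By minimality [A] joins [x] to [y] only through [f]; a connection avoiding [f] would then link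
   the ends of [f] in [F :\ f]. *)
move: Axy; rewrite -(setD1K fA) {1}def_f.
case/conn_add=> [|[/wA xu /wA vy]|[/wA xv /wA uy]]; first by rewrite (negPf nAf).
- rewrite conn_sym in xu; rewrite conn_sym in vy.
  exact: connect_trans (connect_trans xu Ffxy) vy.
- rewrite conn_sym; rewrite conn_sym in xv; rewrite conn_sym in uy.
  exact: connect_trans (connect_trans xv Ffxy) uy.
Qed.

(** * Connected components *)

Definition component A x : {set V} := [set y | connect (adj A) x y].

Definition components A : {set {set V}} := [set component A x | x : V].

Lemma component_eq A x y : connect (adj A) x y -> component A x = component A y.
Proof.
by move=> xy; apply/setP=> z; rewrite !inE (same_connect (@conn_sym A) xy).
Qed.

Lemma component_refl A x : x \in component A x.
Proof. by rewrite inE. Qed.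

Lemma eq_components A B :
  (forall x y, connect (adj A) x y = connect (adj B) x y) ->
  components A = components B.
Proof. by move=> eqAB; apply: eq_imset => x; apply/setP=> y; rewrite !inE eqAB. Qed.

(** The map [h] sends each component of [A] to the component of [B] containing it; it is onto and
    merges the components of [x] and [y]. *)
Lemma components_lt A B x y : A \subset B ->
  connect (adj B) x y -> ~~ connect (adj A) x y ->
  #|components B| < #|components A|.
Proof.
move=> sAB Bxy nAxy; pose h U : {set V} := [set z | [exists u in U, connect (adj B) u z]].
have hE z : h (component A z) = component B z.
  apply/setP=> w; rewrite !inE; apply/exists_inP/idP => [[u] | zw].
    by rewrite inE => /(connS sAB) zu /(connect_trans zu).
  by exists z; rewrite ?inE.
have -> : components B = h @: components A.
  by rewrite /components -imset_comp; apply: eq_imset => z /=; rewrite hE.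
rewrite ltn_neqAle leq_imset_card andbT; apply/negP=> /imset_injP inj_h.
case/negP: nAxy; have: y \in component A y by apply: component_refl.
rewrite -(inj_h (component A x) (component A y)) ?imset_f ?inE //.
by rewrite !hE; apply: component_eq.
Qed.

(** When the missing edges of [F] are added to [A] one at a time, each merges two components,
    because it is a bridge of [F]. *)
Lemma forest_components A F : simple_graph F -> forest F -> A \subset F ->
  #|F :\: A| + #|components F| <= #|components A|.
Proof.
move=> sF fF; move def_n: #|F :\: A| => n; elim: n A def_n => [|n IHn] A.
  move=> /eqP; rewrite cards_eq0 setD_eq0 => sFA sAF.
  by have -> : A = F; last by []; apply/eqP; rewrite eqEsubset sAF.
move=> def_n sAF.
have [e eFA] : exists e, e \in F :\: A by apply/card_gt0P; rewrite def_n.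
have [nAe Fe] : e \notin A /\ e \in F by move: eFA; rewrite inE; case/andP.
have [x [y [_ def_e]]] := simple_edgeP sF Fe.
rewrite addSn; apply: leq_ltn_trans (@components_lt A (e |: A) x y _ _ _).
- apply: IHn; last by rewrite subUset sub1set Fe.
  move: def_n; rewrite (cardsD1 e) eFA => [[<-]]; congr #|pred_of_set _|.
  by apply/setP=> f; rewrite !inE negb_or andbA.
- exact: subsetUr.
- by apply: connect1; rewrite /adj -def_e setU11.
- move/forestP/(_ x y): fF; rewrite -def_e => /(_ Fe); apply: contra.
  by apply: connS; rewrite subsetD1 sAF.
Qed.

End Connectivity.

(** * Packing spanning connected subgraphs *)

Section TreePacking.

Variables (V I : finType) (E : {set {set V}}).
Hypothesis sE : simple_graph E.
Implicit Types (A : {set {set V}}) (e f U : {set V}) (x y z u v : V) (i j : I).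

Definition crosses U f : bool := (f :&: U != set0) && ~~ (f \subset U).

Lemma crosses_set2 U x y : crosses U [set x; y] = ((x \in U) != (y \in U)).
Proof.
have -> : crosses U [set x; y] = ((x \in U) || (y \in U)) && ~~ ((x \in U) && (y \in U)).
  rewrite /crosses subUset !sub1set; congr (_ && _).
  apply/set0Pn/orP => [[z] | [zU|zU]].
  - by rewrite !inE => /andP[/pred2P[]->]; auto.
  - by exists x; rewrite !inE eqxx.
  - by exists y; rewrite !inE eqxx orbT.
by case: (x \in U); case: (y \in U).
Qed.

Definition cut U : {set {set V}} := [set f in E | crosses U f].

(** Once [cut U] is removed, no edge leaves [U], so fewer than [k] edges cannot make up this cut. *)
Lemma cut_card (k : nat) U x y : edge_connected k E ->
  x \in U -> y \notin U -> k <= #|cut U|.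
Proof.
move=> kE xU nyU; rewrite leqNgt; apply/negP=> ltk.
have cE : cut U \subset E by apply/subsetP=> f; rewrite inE; case/andP.
have [_ /(_ x y)] := kE _ cE ltk.
have clU : closed (adj (E :\: cut U)) (mem U).
  move=> u v; rewrite /adj !inE crosses_set2.
  by case/andP=> /nandP[/negPf nE|/negPn/eqP//]; rewrite nE.
by move/(closed_connect clU); rewrite xU (negPf nyU).
Qed.

(* A family of pairwise disjoint edge sets indexed by [I] is encoded as a partial
   colouring of the edges. *)
Implicit Type c : {ffun {set V} -> option I}.

Definition class c i : {set {set V}} := [set f in E | c f == Some i].

Definition uncoloured c : {set {set V}} := [set f in E | c f == None].

Definition forests c : bool := [forall i, forest (class c i)].

Definition exchange c e i f : {ffun {set V} -> option I} :=
  [ffun g => if g == e then Some i else if g == f then None else c g].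

Lemma class_sub c i : class c i \subset E.
Proof. by apply/subsetP=> f; rewrite inE; case/andP. Qed.

Lemma class_exchange c e i f j : e \in uncoloured c -> f \in class c i ->
  class (exchange c e i f) j = if j == i then e |: (class c i :\ f) else class c j.
Proof.
rewrite !inE => /andP[eE /eqP ce] /andP[fE /eqP cf]; apply/setP=> g.
have [->|nji] := eqVneq j i; rewrite !inE ffunE.
  by case: (eqVneq g e) => [->|_]; rewrite ?eE ?eqxx //=; case: (eqVneq g f); rewrite ?andbF.
have nij : (Some i == Some j) = false by apply/eqP=> -[eij]; rewrite eij eqxx in nji.
case: (eqVneq g e) => [->|_]; first by rewrite ce nij.
by case: (eqVneq g f) => [->|//]; rewrite cf nij.
Qed.

Lemma uncoloured_exchange c e i f : e \in uncoloured c -> f \in class c i ->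
  uncoloured (exchange c e i f) = f |: (uncoloured c :\ e).
Proof.
rewrite !inE => /andP[eE /eqP ce] /andP[fE /eqP cf]; apply/setP=> g; rewrite !inE ffunE.
have nef : e != f by apply/eqP=> eqef; move: ce; rewrite eqef cf.
case: (eqVneq g e) => [->|_]; first by rewrite (negPf nef) andbF.
by case: (eqVneq g f) => [->|]; rewrite ?fE.
Qed.

Definition step c c' : bool :=
  forests c' && [exists e in uncoloured c, exists i, exists f in class c i,
                   c' == exchange c e i f].

Lemma stepP c c' :
  reflect (forests c' /\ exists e i f, [/\ e \in uncoloured c, f \in class c i &
             c' = exchange c e i f]) (step c c').
Proof.
apply: (iffP andP) => -[fc' h]; split=> //.
  case/exists_inP: h => e ec /existsP[i /exists_inP[f fc /eqP->]].
  by exists e, i, f.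
case: h => e [i [f [ec fc ->]]]; apply/exists_inP; exists e => //.
by apply/existsP; exists i; apply/exists_inP; exists f.
Qed.

(** The coloured edges then form a basis in the union of [#|I|] copies of the graphic matroid of
    [E]. *)
Definition optimal c : Prop :=
  forests c /\ forall c', forests c' -> #|uncoloured c| <= #|uncoloured c'|.

Lemma exists_optimal : exists c, optimal c.
Proof.
have f0 : forests [ffun=> None].
  apply/forallP=> i; have -> : class [ffun=> None] i = set0; last exact: forest0.
  by apply/setP=> f; rewrite !inE ffunE andbF.
by case: (arg_minnP (fun c => #|uncoloured c|) f0) => c fc minc; exists c.
Qed.

(** An exchange trades one uncoloured edge for another, so their number is unchanged. *)
Lemma step_optimal c c' : step c c' -> optimal c -> optimal c'.
Proof.
case/stepP=> fc' [e [i [f [ec fc def_c']]]] [_ minc]; split=> // c'' /minc.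
rewrite def_c' uncoloured_exchange // cardsU1 !inE.
have -> : c f == None = false by move: fc; rewrite inE => /andP[_ /eqP->].
by rewrite !andbF add1n [X in _ <= X -> _]/= (cardsD1 e) ec.
Qed.

(** Otherwise [e] could be added to class [i], which would remain a forest, and one edge fewer would
    be uncoloured. *)
Lemma optimal_spans c e i x y : optimal c -> e = [set x; y] ->
  e \in uncoloured c -> connect (adj (class c i)) x y.
Proof.
case=> fc minc def_e ec; apply/negPn/negP=> nxy.
pose c' : {ffun {set V} -> option I} := [ffun g => if g == e then Some i else c g].
have [eE /eqP ce] : e \in E /\ c e == None by move: ec; rewrite inE => /andP.
have uc' : uncoloured c' = uncoloured c :\ e.
  by apply/setP=> g; rewrite !inE ffunE; case: (eqVneq g e) => //= _; rewrite andbF.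
have: forests c'.
  apply/forallP=> j; have := forallP fc j; have [->|nji] := eqVneq j i => fj.
    have -> : class c' i = [set x; y] |: class c i; last exact: forest_add.
    apply/setP=> g; rewrite -def_e !inE ffunE; case: (eqVneq g e) => [->|//].
    by rewrite eE eqxx.
  have -> : class c' j = class c j; last by [].
  have nij : (Some i == Some j) = false by apply/eqP=> -[eij]; rewrite eij eqxx in nji.
  by apply/setP=> g; rewrite !inE ffunE; case: (eqVneq g e) => [->|//]; rewrite ce nij.
by move/minc; rewrite uc' (cardsD1 e (uncoloured c)) ec ltnn.
Qed.

(** * Exchange sequences from an optimal colouring *)

Section Reachable.

Variable c0 : {ffun {set V} -> option I}.
Hypothesis opt0 : optimal c0.

(* Maximality makes every missing edge [e] lie in the span of each colour class, and
   the edges of the path it closes up can be exchanged for [e]; hence the spans of the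
   classes inside [exchangeable] do not grow along exchanges, and each class spans
   [exchangeable] from inside. *)
Definition exchangeable : {set {set V}} :=
  [set e | [exists c, connect step c0 c && (e \in uncoloured c)]].
Local Notation X := exchangeable.

Lemma reach_exchangeable c e : connect step c0 c -> e \in uncoloured c -> e \in X.
Proof. by move=> rc ec; rewrite inE; apply/existsP; exists c; rewrite rc. Qed.

Lemma reach_optimal c : connect step c0 c -> optimal c.
Proof.
case/connectP=> p; elim/last_ind: p c => [|p c' IHp] c /=; first by move=> _ ->.
rewrite rcons_path last_rcons => /andP[/IHp/(_ erefl) opt st] ->.
exact: step_optimal st opt.
Qed.

Lemma uncoloured_spanned c e i x y : connect step c0 c -> e = [set x; y] ->
  e \in uncoloured c -> connect (adj (class c i :&: X)) x y.
Proof.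
move=> rc def_e ec; have opt := reach_optimal rc.
have cxy := optimal_spans i opt def_e ec.
have fi := forallP opt.1 i.
have [A sAc [Axy sepA]] := forest_path (simple_graphS (class_sub c i) sE) fi cxy.
apply: connS Axy; apply/subsetP=> f fA; rewrite inE (subsetP sAc) //=.
have fc := subsetP sAc _ fA.
(* Since [f] separates [x] from [y] in its class, replacing it by [e] leaves a forest; this exchange
   makes [f] uncoloured, hence exchangeable. *)
have st : step c (exchange c e i f).
  apply/stepP; split; last by exists e, i, f.
  apply/forallP=> j; rewrite class_exchange //; case: eqP => _; last exact: forallP opt.1 j.
  rewrite def_e; apply: forest_add; last exact: sepA.
  exact: forestS (subsetDl _ _) fi.
apply: (@reach_exchangeable (exchange c e i f)); first exact: connect_trans rc (connect1 st).
by rewrite uncoloured_exchange // setU11.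
Qed.

(** The only edge that a class can gain is [e], whose ends the same class of [c] already joins
    within [X]. *)
Lemma step_span c c' i x y : connect step c0 c -> step c c' ->
  connect (adj (class c' i :&: X)) x y -> connect (adj (class c i :&: X)) x y.
Proof.
move=> rc /stepP[_ [e [j [f [ec fc ->]]]]]; rewrite class_exchange //.
case: eqP => [->|//]; apply: connect_sub => u v; rewrite /adj !inE.
case/andP=> /orP[/eqP uv_e _|/andP[_ uvc] uvX].
  by apply: uncoloured_spanned (esym uv_e) _.
by apply: connect1; rewrite /adj !inE uvc uvX.
Qed.

Lemma reach_span c i x y : connect step c0 c ->
  connect (adj (class c i :&: X)) x y -> connect (adj (class c0 i :&: X)) x y.
Proof.
case/connectP=> p; elim/last_ind: p c => [|p c' IHp] c /=; first by move=> _ ->.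
rewrite rcons_path last_rcons => /andP[pp st] ->.
have rp : connect step c0 (last c0 p) by apply/connectP; exists p.
by move/(step_span rp st); apply: IHp.
Qed.

(** Each edge of [X] is uncoloured in some reachable colouring, where class [i] joins its ends
    within [X]; that connection is carried back to [c0]. *)
Lemma exchangeable_spanned i x y :
  connect (adj X) x y = connect (adj (class c0 i :&: X)) x y.
Proof.
apply/idP/idP; last exact/connS/subsetIr.
apply: connect_sub => u v; rewrite /adj inE => /existsP[c /andP[rc uvc]].
exact/(reach_span rc)/(uncoloured_spanned _ rc erefl uvc).
Qed.

(** An edge between components of [X] is outside [X], hence coloured by [c0]. Each class is a forest
    whose part inside [X] has the same components as [X], so at most [#|components X|.-1] of its
    edges lie outside [X]. *)
Lemma card_crossing (x0 : V) :
  #|[set f in E | [exists U in components X, crosses U f]]|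
    <= #|I| * #|components X|.-1.
Proof.
set D := [set f in E | _].
have sD : D \subset \bigcup_i (class c0 i :\: X).
  apply/subsetP=> f; rewrite inE => /andP[fE /exists_inP[U /imsetP[z _ ->] cUf]].
  have [x [y [_ def_f]]] := simple_edgeP sE fE.
  have nfX : f \notin X.
    apply: contraL cUf => fX; rewrite def_f crosses_set2 !inE negbK.
    have xy : connect (adj X) x y by apply: connect1; rewrite /adj -def_f.
    by rewrite -!(@conn_sym _ _ _ z) (same_connect (@conn_sym _ X) xy).
  have nfc : f \notin uncoloured c0 by apply: contra nfX; apply: reach_exchangeable.
  move: nfc; rewrite inE fE /=; case cf: (c0 f) => [i|//] _.
  by apply/bigcupP; exists i; rewrite // in_setD nfX inE fE cf eqxx.
apply: leq_trans (subset_leq_card sD) _.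
apply: (@leq_trans (\sum_(i : I) #|class c0 i :\: X|)).
  apply: (big_rec2 (fun (A : {set {set V}}) n => #|A| <= n)); first by rewrite cards0.
  move=> i A n _ le; apply: leq_trans (_ : _ <= #|class c0 i :\: X| + #|A|) _.
    by rewrite cardsU leq_subr.
  by rewrite leq_add2l.
rewrite -sum_nat_const; apply: leq_sum => i _.
have fi := forallP opt0.1 i.
have := forest_components (simple_graphS (class_sub c0 i) sE) fi (subsetIl _ X).
rewrite setDIr setDv set0U.
have -> : components (class c0 i :&: X) = components X.
  by apply: eq_components => x y; rewrite -exchangeable_spanned.
(* The vertex [x0] shows that the class has at least one component, which accounts for the
   predecessor in the bound. *)
move=> le; rewrite -ltnS (@leq_trans #|components X|) ?leqSpred //.
apply: leq_trans le; rewrite -addn1 leq_add2l.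
by apply/card_gt0P; exists (component (class c0 i) x0); apply: imset_f.
Qed.

End Reachable.

(** Double counting: an edge crosses only blocks that contain one of its ends, and by disjointness
    there are at most two of these. *)
Lemma sum_cut (P : {set {set V}}) : trivIset P ->
  \sum_(U in P) #|cut U| <= 2 * #|[set f in E | [exists U in P, crosses U f]]|.
Proof.
move=> tP; set D := [set f in E | _].
have -> : \sum_(U in P) #|cut U| = \sum_(f in D) #|[set U in P | crosses U f]|.
  under eq_bigr do rewrite -sum1_card.
  rewrite (exchange_big_dep (mem D)) /=.
    by apply: eq_bigr => f fD; rewrite -sum1_card; apply: eq_bigl => U; rewrite !inE;
       move: fD; rewrite inE => /andP[->].
  move=> U f UP; rewrite !inE => /andP[-> cUf].
  by apply/exists_inP; exists U.
rewrite mulnC -sum_nat_const; apply: leq_sum => f; rewrite inE => /andP[fE _].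
have [x [y [_ ->]]] := simple_edgeP sE fE.
apply: leq_trans (_ : #|[set pblock P x; pblock P y]| <= 2); last by rewrite cards2; case: eqP.
apply/subset_leq_card/subsetP=> U; rewrite !inE crosses_set2 => /andP[UP].
case xU: (x \in U); case yU: (y \in U) => // _; apply/orP; [left|right]; apply/eqP/esym;
  exact: def_pblock.
Qed.

Lemma trivIset_components A : trivIset (components A).
Proof.
apply/trivIsetP=> _ _ /imsetP[x _ ->] /imsetP[y _ ->]; apply: contraR.
case/pred0Pn=> z /andP[]; rewrite /= !inE => xz yz; apply/eqP/component_eq.
by rewrite (@conn_sym _ _ y) in yz; apply: connect_trans xz yz.
Qed.

(** If [X] had [m > 1] components, the cuts around them would give at least [m * #|I|] crossing
    edges, against the bound [#|I| * m.-1] of [card_crossing]. So [X] connects all vertices, and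
    every class spans it. *)
Theorem tree_packing : edge_connected #|I|.*2 E ->
  exists F : I -> {set {set V}},
    [/\ forall i, F i \subset E, forall i, connected (F i) &
        forall i j, i != j -> [disjoint F i & F j]].
Proof.
move=> kE; have [c opt] := exists_optimal.
exists (class c); split=> [i|i|i j nij]; first exact: class_sub; last first.
  rewrite -setI_eq0; apply/eqP/setP=> f; rewrite !inE; apply/negP.
  case/andP=> /andP[_ /eqP->] /andP[_ /eqP[eij]]; by rewrite eij eqxx in nij.
have k0 : 0 < #|I| by apply/card_gt0P; exists i.
have [V0 _] : connected (E :\: set0) by apply: kE; rewrite ?sub0set // cards0 double_gt0.
split=> // x y; set X := exchangeable c.
suff : connect (adj X) x y.
  by rewrite (exchangeable_spanned opt i); apply/connS/subsetIl.
apply/negPn/negP=> nxy; have := card_crossing opt x.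
rewrite -/X -(leq_pmul2l (isT : 0 < 2)) leqNgt => /negP; apply.
apply: leq_trans (sum_cut (trivIset_components X)).
apply: (@leq_trans (#|components X| * #|I|.*2)).
  have C0 : 0 < #|components X| by apply/card_gt0P; exists (component X x); apply: imset_f.
  by rewrite mulnA mul2n mulnC ltn_pmul2r ?double_gt0 // prednK.
rewrite -sum_nat_const; apply: leq_sum => U /imsetP[z _ ->].
(* As [x] and [y] lie in different components, one of them is outside the component of [z]. *)
have [w nzw] : exists w, w \notin component X z.
  have [zx|nzx] := boolP (connect (adj X) z x); last by exists x; rewrite inE.
  exists y; rewrite inE; apply: contra nxy => zy.
  by rewrite (@conn_sym _ _ z) in zx; apply: connect_trans zx zy.
exact: cut_card kE (component_refl X z) nzw.
Qed.

End TreePacking.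

(** * Joins *)

Section Joins.

Variable V : finType.
Implicit Types (A B F J : {set {set V}}) (f : {set V}) (x y v : V) (p : seq V).

Definition degree A v : nat := #|[set f in A | v \in f]|.

Lemma degree0 v : degree set0 v = 0.
Proof.
by rewrite /degree (_ : [set f in _ | _] = set0) ?cards0 //; apply/setP=> f; rewrite !inE.
Qed.

Lemma degree1 f v : degree [set f] v = (v \in f).
Proof.
rewrite /degree; case vf: (v \in f).
  rewrite (_ : [set g in _ | _] = [set f]) ?cards1 //.
  by apply/setP=> g; rewrite !inE; case: eqP => // ->; rewrite vf.
rewrite (_ : [set g in _ | _] = set0) ?cards0 //.
by apply/setP=> g; rewrite !inE; case: eqP => // ->; rewrite vf.
Qed.

Lemma degreeU A B v : [disjoint A & B] -> degree (A :|: B) v = degree A v + degree B v.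
Proof.
move=> dAB; rewrite /degree -cardsUI -[LHS]addn0; congr (_ + _).
  by congr #|pred_of_set _|; apply/setP=> f; rewrite !inE andb_orl.
symmetry; apply/eqP; rewrite cards_eq0; apply/eqP/setP=> f; rewrite !inE.
by move/pred0P/(_ f): dAB => /=; case: (f \in A); case: (f \in B); rewrite ?andbF.
Qed.

(** The common edges count in both degrees and cancel modulo 2. *)
Lemma odd_degree_symdiff A B v :
  odd (degree ((A :\: B) :|: (B :\: A)) v) = odd (degree A v) (+) odd (degree B v).
Proof.
have dD F G : [disjoint F :\: G & G].
  by rewrite -setI_eq0; apply/eqP/setP=> f; rewrite !inE; case: (f \in G); rewrite ?andbF.
rewrite degreeU; last first.
  by apply: disjointWr (dD A B); exact: subsetDl.
have deg_split F G : degree F v = degree (F :\: G) v + degree (F :&: G) v.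
  rewrite -degreeU; first by rewrite setUC setID.
  by apply: disjointWr (dD F G); exact: subsetIr.
rewrite (deg_split A B) (deg_split B A) (setIC B A) !oddD.
by case: (odd (degree (A :\: B) v)); case: (odd (degree (B :\: A) v));
   case: (odd (degree (A :&: B) v)).
Qed.

Lemma sum_degree A : simple_graph A -> \sum_v degree A v = 2 * #|A|.
Proof.
move=> sA; rewrite mulnC -sum_nat_const.
under eq_bigr do rewrite /degree -sum1_card.
rewrite (exchange_big_dep (mem A)) /=; last by move=> v f _; rewrite inE => /andP[].
apply: eq_bigr => f fA; rewrite -(sA f fA) -sum1_card.
by apply: eq_bigl => v; rewrite inE fA.
Qed.

(** A walk may repeat edges, so its edges are summed modulo 2 by symmetric differences; the
    contributions at inner visits cancel. *)
Lemma path_join F p x : simple_graph F -> path (adj F) x p ->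
  exists2 J : {set {set V}}, J \subset F &
    forall v, odd (degree J v) = (v == x) (+) (v == last x p).
Proof.
move=> sF; elim: p x => [|y p IHp] x /=.
  by move=> _; exists set0 => [|v]; rewrite ?sub0set // addbb degree0.
case/andP=> xy /IHp[J sJF degJ].
exists (([set [set x; y]] :\: J) :|: (J :\: [set [set x; y]])) => [|v].
  by rewrite subUset !(subset_trans (subsetDl _ _)) // sub1set.
rewrite odd_degree_symdiff degJ addbA; congr (_ (+) _).
rewrite degree1 oddb in_set2.
by case: (eqVneq v x) => [->|_] /=; rewrite ?addbb ?(negPf (adj_neq sF xy)).
Qed.

(** The vertices of [T] are taken off in pairs, each pair contributing, modulo 2, the edges of a
    walk joining them. *)
Lemma exists_join F (T : {set V}) : simple_graph F -> connected F -> ~~ odd #|T| ->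
  exists2 J : {set {set V}}, J \subset F & forall v, odd (degree J v) = (v \in T).
Proof.
move=> sF [_ cF]; have [n] := ubnP #|T|; elim: n T => // n IHn T leT evT.
have [->|[x xT]] := set_0Vmem T.
  by exists set0 => [|v]; rewrite ?sub0set // inE degree0.
have [T1|[y]] := set_0Vmem (T :\ x); first by rewrite (cardsD1 x) xT T1 cards0 in evT.
move=> yT; rewrite (cardsD1 x) xT (cardsD1 y) yT /= negbK in leT evT.
have [J sJF degJ] := IHn _ (ltnW leT) evT.
have /connectP[p pp yl] := cF x y.
have [K sKF degK] := path_join sF pp.
exists ((J :\: K) :|: (K :\: J)) => [|v].
  by rewrite subUset !(subset_trans (subsetDl _ _)).
rewrite odd_degree_symdiff degJ degK -yl !inE; move: yT; rewrite !inE => /andP[nyx yT].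
case: (eqVneq v y) => [->|_]; first by rewrite (negPf nyx) yT.
by case: (eqVneq v x) => [->|_] //=; rewrite addbF.
Qed.

End Joins.

(** * Closed walks *)

Section Walks.

Variables (V : finType) (E : {set {set V}}).
Hypothesis sE : simple_graph E.
Implicit Types (F : {set {set V}}) (f : {set V}) (x y u v : V) (p q : seq V).

Lemma walk_edges_cat x p q :
  walk_edges x (p ++ q) = walk_edges x p ++ walk_edges (last x p) q.
Proof. exact: pairmap_cat. Qed.

Lemma walk_edges_sub x p f : f \in walk_edges x p -> f \subset x :: p.
Proof.
elim: p x => //= y p IHp x; rewrite inE => /predU1P[->|/IHp sf].
  by apply/subsetP=> z; rewrite !inE => /pred2P[]->; rewrite eqxx ?orbT.
by apply/subsetP=> z /(subsetP sf) zp; rewrite inE zp orbT.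
Qed.

Lemma uniq_walk_edges x p : uniq (x :: p) -> uniq (walk_edges x p).
Proof.
elim: p x => //= y p IHp x /andP[nx /IHp->]; rewrite andbT.
apply: contra nx => /walk_edges_sub/subsetP/(_ x); apply; exact: set21.
Qed.

(** Without its last step the walk has distinct vertices. The closing edge could only repeat the
    first edge, and only in a walk of length 2, which odd length excludes. *)
Lemma uniq_closed_walk_edges x p : closed_walk E x p -> odd (size p) -> uniq p ->
  uniq (walk_edges x p).
Proof.
case: (lastP p) => // q z [pq]; rewrite last_rcons => zx.
rewrite {}zx in pq *; rewrite rcons_uniq size_rcons /= => evq /andP[nxq uq].
have uxq : uniq (x :: q) by rewrite /= nxq.
rewrite -cats1 walk_edges_cat cat_uniq uniq_walk_edges //= orbF andbT.
case: q pq evq nxq uq uxq => [|y q] //=; rewrite negbK inE negb_or => /andP[xy _] oq.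
case/andP=> nxy nxq /andP[nyq uq] _; rewrite inE negb_or; apply/andP; split.
  apply/eqP; rewrite setUC => /eq_set2[][ex ey]; last by rewrite ex eqxx in nxy.
  case: q oq nyq {nxq uq} ey => // w q _ nyq /=.
  by move=> ey; rewrite -ey mem_last in nyq.
apply/negP=> /walk_edges_sub/subsetP/(_ x (set22 _ _)).
by rewrite inE (negPf nxy) (negPf nxq).
Qed.

Lemma nuniq_split p : ~~ uniq p ->
  exists z p1 p2 p3, p = rcons p1 z ++ rcons p2 z ++ p3.
Proof.
elim: p => //= x p IHp; rewrite negb_and negbK.
have [/splitPr[p1 p2] _|_ /IHp[z [p1 [p2 [p3 ->]]]]] := boolP (x \in p).
  by exists x, [::], p1, p2; rewrite /= cat_rcons.
by exists z, (x :: p1), p2, p3.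
Qed.

(** A repeated vertex [z] splits the walk into two shorter closed walks, one of which has odd
    length. *)
Lemma uniq_odd_closed_walk x p : closed_walk E x p -> odd (size p) ->
  exists y q, [/\ closed_walk E y q, odd (size q) & uniq q].
Proof.
have [n] := ubnP (size p); elim: n x p => // n IHn x p lepn cw op.
have [up|] := boolP (uniq p); first by exists x, p.
case/nuniq_split=> z [p1 [p2 [p3 def_p]]]; move: cw op lepn.
rewrite def_p /closed_walk !cat_path !last_cat !last_rcons !size_cat !size_rcons.
case=> /and3P[pp1 pp2 pp3] lp3 op; rewrite ltnS => lepn.
have [o2|e2] := boolP (odd (size (rcons p2 z))).
  apply: (IHn z (rcons p2 z)) o2; last by rewrite /closed_walk last_rcons.
  by rewrite size_rcons; apply: leq_trans lepn; rewrite addSn ltnS addnCA leq_addr.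
apply: (IHn x (rcons p1 z ++ p3)).
- rewrite size_cat size_rcons; apply: leq_trans lepn.
  by rewrite -addnS leq_add2l addSn ltnS leq_addl.
- by rewrite /closed_walk cat_path last_cat last_rcons pp1.
- rewrite size_rcons /= in e2; move: op; rewrite size_cat size_rcons !oddD /= (negPf e2).
  by rewrite addFb.
Qed.

Lemma odd_closed_walk_exists : connected E -> ~ bipartite E ->
  exists x p, closed_walk E x p /\ odd (size p).
Proof.
case=> /card_gt0P[r _] cE nbip.
(* The relation [d] is adjacency in the bipartite double cover: a path between the two copies of [x]
   projects to an odd closed walk. *)
pose d : rel (V * bool) := fun a b => adj E a.1 b.1 && (a.2 != b.2).
have dwalk (p : seq (V * bool)) a : path d a p ->
    path (adj E) a.1 (map fst p) /\ (last a p).2 = a.2 (+) odd (size p).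
  elim: p a => [|b p IHp] a /=; first by rewrite addbF.
  by case/andP=> /andP[-> ab] /IHp[-> ->]; split=> //; move: ab; case: (a.2); case: (b.2); case: (odd _).
have wd p x b : path (adj E) x p -> connect d (x, b) (last x p, b (+) odd (size p)).
  elim: p x b => [|y p IHp] x b /=; first by rewrite addbF.
  case/andP=> xy /(IHp _ (~~ b)); rewrite addbN addNb; apply: connect_trans.
  by apply: connect1; rewrite /d /= xy; case: b.
have dsym : connect_sym d.
  by apply: sym_connect_sym => a b; rewrite /d adj_sym eq_sym.
suff [x cx] : exists x, connect d (x, false) (x, true).
  have /connectP[p /dwalk[pp op] lp] := cx.
  exists x, (map fst p); rewrite size_map; split; last by move: op; rewrite -lp.
  by split; rewrite // -[x in last x]/((x, false).1) last_map -lp.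
have [/existsP//|nd] := boolP [exists x, connect d (x, false) (x, true)].
(* One side consists of the vertices reached from [r] by walks of even length. If an edge had both
   ends on the same side, copies of [x] and [y] at one level would be joined through [r], and the
   edge would then join the two copies of [x]. *)
case: nbip; exists [set x | connect d (r, false) (x, false)] => x y xy.
rewrite !inE; apply/eqP=> exy; case/existsP: nd; exists x.
have dxy b : connect d (x, b) (y, ~~ b) by apply: connect1; rewrite /d /= xy; case: b.
have rc z : connect d (r, false) (z, false) || connect d (r, false) (z, true).
  have /connectP[p pp ->] := cE r z; have := wd p r false pp; rewrite addFb.
  by case: odd => ->; rewrite ?orbT.
have both z : connect d (r, false) (z, false) = false -> connect d (r, false) (z, true).
  by move=> nz; move: (rc z); rewrite nz.
case rx: (connect d (r, false) (x, false)) exy => /esym ry.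
  rewrite dsym in rx; have := connect_trans (connect_trans rx ry) _; apply.
  by rewrite dsym; apply: dxy true.
rewrite dsym; have {}rx := both _ rx; have {}ry := both _ ry; rewrite dsym in rx.
by apply: connect_trans (connect_trans rx ry) _; rewrite dsym; apply: dxy false.
Qed.

(* The walk [q] makes the detour [u, v, u] at one of the visits of [u]. *)
Lemma splice_edge x p u v : closed_walk E x p -> adj E u v -> u \in x :: p ->
  exists q, [/\ closed_walk E x q,
    forall z, visit_number q z = visit_number p z + (z \in [set u; v]) &
    forall f, count_mem f (walk_edges x q) =
              count_mem f (walk_edges x p) + 2 * (f == [set u; v])].
Proof.
move=> [pp lp] uv up; move: pp lp; have nuv := adj_neq sE uv.
case/splitPl: up => p1 p2 l1; rewrite cat_path last_cat l1 => /andP[pp1 pp2] lp.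
exists (p1 ++ [:: v, u & p2]); split=> [|z|f].
- by split; rewrite ?last_cat // cat_path pp1 /= l1 uv adj_sym uv.
- rewrite /visit_number !count_cat /= in_set2 -addnA; congr (_ + _).
  rewrite addnA addnC; congr (_ + _); rewrite !(eq_sym _ z).
  by case: (eqVneq z u) => [->|_]; rewrite ?(negPf nuv) ?addn0.
- rewrite !walk_edges_cat !count_cat /= l1 -!addnA; congr (_ + _).
  rewrite (setUC [set v]) addnA addnC (eq_sym f) mul2n -addnn; congr (_ + _).
Qed.

(** The edges of [F] are inserted one at a time, [S] being those already done; connectivity of [F]
    ensures that some remaining edge meets the walk. *)
Lemma double_walk F x p : F \subset E -> connected F -> closed_walk E x p ->
  exists q, [/\ closed_walk E x q,
    forall v, visit_number q v = visit_number p v + degree F v &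
    forall f, count_mem f (walk_edges x q) =
              count_mem f (walk_edges x p) + 2 * (f \in F)].
Proof.
move=> sFE [_ cF] cw.
suff grow n : n <= #|F| -> exists (S : {set {set V}}) q,
  [/\ S \subset F, #|S| = n & [/\ closed_walk E x q,
    forall v, visit_number q v = visit_number p v + degree S v &
    forall f, count_mem f (walk_edges x q) =
              count_mem f (walk_edges x p) + 2 * (f \in S)]].
  have [S [q [sSF cS]]] := grow _ (leqnn #|F|).
  have -> : S = F; last by exists q.
  by apply/eqP; rewrite eqEcard sSF cS leqnn.
elim: n => [|n IHn] ltnF.
  exists set0, p; split; rewrite ?sub0set ?cards0 //.
  by split=> // [v|f]; rewrite ?degree0 ?inE addn0.
have [S [q [sSF cS [cwq visq cntq]]]] := IHn (ltnW ltnF).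
(* The start [x] counts as visited here, so that the empty walk can also receive a detour. *)
have [u [v [uvF nuvS uq]]] : exists u v, [/\ [set u; v] \in F, [set u; v] \notin S & u \in x :: q].
  have [/existsP[u /existsP[v /and3P[]]]|none] :=
    boolP [exists u, exists v, [&& [set u; v] \in F, [set u; v] \notin S & u \in x :: q]].
    by exists u, v.
  (* Every edge of [F] at a visited vertex would then be in [S] and so be traversed by [q]. The
     visited set would be closed under [F], hence contain all vertices, in particular the ends of
     any remaining edge. *)
  have visS u v : [set u; v] \in F -> u \in x :: q -> [set u; v] \in S.
    move=> uvF uq; apply: contraR none => nS.
    by apply/existsP; exists u; apply/existsP; exists v; rewrite uvF nS.
  have cl : closed (adj F) (mem (x :: q)).
    apply: intro_closed; first exact: conn_sym.
    move=> u v uv /(visS _ _ uv) uvS.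
    have: [set u; v] \in walk_edges x q.
      by rewrite -has_pred1 has_count cntq uvS addn_gt0 orbT.
    by move/walk_edges_sub/subsetP/(_ v (set22 _ _)).
  have allq z : z \in x :: q by rewrite -(closed_connect cl (cF x z)) mem_head.
  have [e] : exists e, e \in F :\: S.
    by apply/card_gt0P; rewrite cardsDS // subn_gt0 cS.
  rewrite inE => /andP[nS eF]; have [u [v [_ def_e]]] := simple_edgeP sE (subsetP sFE _ eF).
  by exists u, v; rewrite -def_e.
have [q' [cwq' visq' cntq']] := splice_edge cwq (subsetP sFE _ uvF) uq.
exists ([set u; v] |: S), q'; split; first by rewrite subUset sub1set uvF.
  by rewrite cardsU1 nuvS cS.
split=> // [z|f].
  rewrite visq' visq -addnA; congr (_ + _); rewrite degreeU; last by rewrite disjoints1.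
  by rewrite addnC; congr (_ + _); rewrite degree1.
rewrite cntq' cntq -addnA -mulnDr !inE; congr (_ + 2 * _).
by case: (eqVneq f [set u; v]) => [->|_]; rewrite ?(negPf nuvS) ?addn0.
Qed.

End Walks.

(** * Parity of visit numbers *)

Section Parity.

Variable V : finType.
Implicit Types (E : {set {set V}}) (A : {set V}) (x v : V) (p : seq V).

Lemma odd_sum A (F : V -> nat) :
  odd (\sum_(v in A) F v) = odd #|[set v in A | odd (F v)]|.
Proof.
rewrite -sum1dep_card big_mkcondr /=.
elim/big_rec2: _ => // v m n _ eqmn; rewrite !oddD eqmn.
by case: (odd (F v)).
Qed.

Lemma sum_visits A p : \sum_(v in A) visit_number p v = count (mem A) p.
Proof.
elim: p => [|x p IHp]; first by rewrite big1.
rewrite /= -IHp big_split /=; congr (_ + _).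
have [xA|nxA] := boolP (x \in A).
  rewrite (bigD1 x) //= eqxx big1 ?addn0 // => v /andP[_].
  by rewrite eq_sym => /negPf->.
by rewrite big1 // => v vA; case: eqP nxA => // ->; rewrite vA.
Qed.

(** A step starting in [A] ends outside it, and conversely; the two end terms convert visits counted
    at step ends into visits counted at step starts, and cancel on a closed walk. *)
Lemma alternating_walk E A x p : (forall u v, adj E u v -> (u \in A) != (v \in A)) ->
  path (adj E) x p ->
  count (mem A) p + (x \in A) = count (mem (~: A)) p + (last x p \in A).
Proof.
move=> altA; elim: p x => [|y p IHp] x //= /andP[/altA xy /IHp eqp].
rewrite inE -!addnA -eqp [RHS]addnCA [LHS]addnCA; congr (_ + _).
by case: (x \in A) (y \in A) xy => [] [].
Qed.

Lemma odd_visits_order p : (forall v, odd (visit_number p v)) ->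
  forall A, odd (count (mem A) p) = odd #|A|.
Proof.
move=> op A; rewrite -sum_visits odd_sum; congr (odd #|pred_of_set _|).
by apply/setP=> v; rewrite inE op andbT.
Qed.

Lemma bipartite_PHC E x p : PHC E x p -> bipartite E -> ~~ odd #|V|.
Proof.
case=> -[pp lp] op [A altA]; have := alternating_walk altA pp; rewrite lp => /addIn eqA.
rewrite -(cardsC A) oddD -!(odd_visits_order op) eqA addbb //.
Qed.

Lemma base_walk E : simple_graph E -> connected E -> ~~ odd #|V| \/ ~ bipartite E ->
  exists x p, [/\ closed_walk E x p, odd (size p) = odd #|V| & uniq (walk_edges x p)].
Proof.
move=> sE cE; have [oV [//|nb]|eV _] := boolP (odd #|V|).
  have [x [p [cw op]]] := odd_closed_walk_exists cE nb.
  have [y [q [cwq oq uq]]] := uniq_odd_closed_walk cw op.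
  by exists y, q; split; rewrite ?oq //; apply: uniq_closed_walk_edges cwq oq uq.
by case: cE => /card_gt0P[x _] _; exists x, [::].
Qed.

End Parity.

Theorem theorem3p9 (V : finType) (E : {set {set V}}) (hE : simple_graph E)
    (h4 : edge_connected 4 E) :
  (exists (v0 : V) (p : seq V), PHC_le 3 E v0 p) <->
  (~~ odd #|V| \/ ~ bipartite E).
Proof.
split=> [[x [p [phc _]]]|hV].
  by have [oV|] := boolP (odd #|V|); [right=> /(bipartite_PHC phc); rewrite oV | left].
have cE : connected E by rewrite -(setD0 E); apply: h4; rewrite ?sub0set ?cards0.
have [x [p [cwp op up]]] := base_walk hE cE hV.
(* Four is twice the number of classes, here indexed by the two booleans. *)
have h4' : edge_connected #|{: bool}|.*2 E by rewrite card_bool.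
have [F [sFE cF dF]] := tree_packing hE h4'.
(* [T] collects the vertices whose visit number would still be even after the detours along
   [F true]; the join corrects exactly these. *)
pose T := [set v | ~~ odd (visit_number p v + degree (F true) v)].
have evT : ~~ odd #|T|.
  (* Modulo 2 the visit numbers sum to the length of [p], which has the parity of [#|V|], and the
     degrees sum to 0. *)
  have: odd #|~: T| = odd #|V|.
    have -> : ~: T = [set v in [set: V] | odd (visit_number p v + degree (F true) v)].
      by apply/setP=> v; rewrite !inE negbK.
    rewrite -odd_sum big_split /= oddD sum_visits.
    rewrite (eq_bigl predT) => [|v]; last by rewrite inE.
    rewrite sum_degree; last exact: simple_graphS (sFE true) hE.
    rewrite mul2n odd_double addbF -op -(count_predT p); congr odd.
    by apply: eq_count => v; rewrite !inE.
  by rewrite -(cardsC T) oddD; case: (odd #|T|); case: odd.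
have [J sJF degJ] := exists_join (simple_graphS (sFE false) hE) (cF false) evT.
have dJ : [disjoint F true & J] := disjointWr sJF (dF true false isT).
have sFJE : F true :|: J \subset E.
  by rewrite subUset sFE (subset_trans sJF).
have cFJ : connected (F true :|: J).
  by have [V0 cT] := cF true; split=> // u v; apply: connS (cT u v); apply: subsetUl.
have [q [cwq visq cntq]] := double_walk hE sFJE cFJ cwp.
exists x, q; split; first split=> // v.
  rewrite visq degreeU // addnA oddD degJ inE.
  by case: odd.
move=> f _; rewrite cntq count_uniq_mem //.
by case: (f \in _); case: (f \in _).
Qed.
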